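(* Let $b\ge2$ be an integer and $\Lambda$ a finite alphabet (identified with a finite subset of $\mathbb R$). If $x\in\Lambda^{\mathbb N}$ is automatic with respect to the multiplicative semigroup $(\mathbb N,\times)$ and $b$, then $x$ is strongly deterministic (as a function on the semigroup $G=(\mathbb N,\times)$).
   Context: $\mathbb N=\{1,2,\dots\}$. Let $p_1<p_2<\cdots$ be the primes, and for $N\in\mathbb N$ write $N=\prod_j p_j^{e_j}$ with $e_j=e_j(N)\ge0$. Let $V=\{0,1,\dots,b-1\}$. Let $\phi(N)$ be the finite word over $V$ obtained by concatenating the base-$b$ expansions $\bar e_j$ of the exponents $e_j$ in decreasing order of $j$: $\phi(N)=\dots\bar e_3\bar e_2\bar e_1$, where $e_j=0$ is represented by the empty string (e.g. for $b=10$, $\phi(7^{903}5^23^02^1)=90321$). Write $\phi(N)=v_nv_{n-1}\dots v_0$ with $v_n\ne0$. $x\in\Lambda^{\mathbb N}$ is automatic (with respect to $(\mathbb N,\times)$ and $b$) if there exist a finite set $S$ with a distinguished initial state $s_0\in S$, maps $\alpha_v:S\to S$ ($v\in V$) and a map $\omega:S\to\Lambda$ such that for each $N\in\mathbb N$ with $\phi(N)=v_nv_{n-1}\dots v_0$, $x(N)=\omega(\alpha_{v_0}\circ\alpha_{v_1}\circ\cdots\circ\alpha_{v_n}(s_0))$ (for $N=1$ the word is empty and $x(1)=\omega(s_0)$). For $G=(\mathbb N,\times)$: a F\o lner sequence is a sequence $(F_n)$ of nonempty finite subsets of $G$ with $|KF_n\triangle F_n|/|F_n|\to0$ for every nonempty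 finite $K\subset G$. A dynamical system $(X,G)$ is an action of $G$ by continuous maps on a compact metric space $X$. For an invariant Borel probability measure $\mu$ its entropy is $h(\mu)=\sup_{\mathcal P}\lim_n\frac1{|F_n|}H\big(\mu,\bigvee_{g\in F_n}g^{-1}(\mathcal P)\big)$ ($\mathcal P$ over finite measurable partitions, $H$ Shannon entropy; independent of the F\o lner sequence), and the topological entropy of $(X,G)$ is $\sup_\mu h(\mu)$ over invariant measures. A function $f:G\to\mathbb R$ is strongly deterministic if there are a dynamical system $(X,G)$ of topological entropy zero, a continuous $\varphi:X\to\mathbb R$ and $x_0\in X$ with $f(g)=\varphi(g(x_0))$ for all $g\in G$. *)

(* Defs.v *)
From HB Require Import structures.
From mathcomp Require Import all_boot all_order all_algebra monoid finmap.
From mathcomp Require Import all_classical all_reals all_analysis.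

Set Implicit Arguments.
Unset Strict Implicit.
Unset Printing Implicit Defensive.
Import Order.TTheory GRing.Theory Num.Theory.
Import numFieldNormedType.Exports.

Local Open Scope classical_set_scope.
Local Open Scope ring_scope.

Record posnat :=
  PosNat { nat_of_posnat :> nat; posnat_gt0 : (0 < nat_of_posnat)%N }.

HB.instance Definition _ := [isSub for nat_of_posnat].
HB.instance Definition _ := [Choice of posnat by <:].

Definition posnat_one : posnat := PosNat (ltn0Sn 0).

Lemma posnat_mul_subproof (m n : posnat) : (0 < m * n)%N.
Proof. by rewrite muln_gt0 !posnat_gt0. Qed.

Definition posnat_mul (m n : posnat) : posnat :=
  PosNat (posnat_mul_subproof m n).

Lemma posnat_mulA : associative posnat_mul.
Proof. by move=> m n p; apply/val_inj; rewrite /= mulnA. Qed.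

Lemma posnat_mul1 : left_id posnat_one posnat_mul.
Proof. by move=> m; apply/val_inj; rewrite /= mul1n. Qed.

Lemma posnat_mulr1 : right_id posnat_one posnat_mul.
Proof. by move=> m; apply/val_inj; rewrite /= muln1. Qed.

HB.instance Definition _ :=
  isMonoid.Build posnat posnat_mulA posnat_mul1 posnat_mulr1.

Section Automatic.
Variables (b : nat) (b_gt1 : (1 < b)%N).

Definition digit (n : nat) : 'I_b := Ordinal (ltn_pmod n (ltnW b_gt1)).

(* [fuel] is a bound on the number of digits; the most significant digit comes
   first and 0 has the empty expansion. *)
Fixpoint expansion_rec (fuel n : nat) : seq 'I_b :=
  if fuel is k.+1 then
    if n == 0%N then [::] else rcons (expansion_rec k (n %/ b)) (digit n)
  else [::].

Definition expansion (n : nat) : seq 'I_b := expansion_rec n n.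

(* Primes that do not divide [N] contribute the empty word, so only the prime
   divisors of [N] are listed; [primes N] is increasing. *)
Definition exponent_word (N : posnat) : seq 'I_b :=
  flatten [seq expansion (logn p N) | p <- rev (primes N)].

(* [foldl] reads the word from the left, so the leading letter acts first. *)
Definition automatic (Lam : Type) (x : posnat -> Lam) : Prop :=
  exists (S : finType) (s0 : S) (alpha : 'I_b -> S -> S) (omega : S -> Lam),
    forall N, x N = omega (foldl (fun s v => alpha v s) s0 (exponent_word N)).

End Automatic.

(* [metricType] has no base point, which [g_sigma_algebraType] requires. *)
#[short(type="pmetricType")]
HB.structure Definition PMetric (K : numDomainType) :=
  { M of Metric K M & Pointed M }.

Definition borel (X : ptopologicalType) := g_sigma_algebraType (@open X).

Definition folner (R : realType) (G : monoidType) (F : nat -> {fset G}) : Prop :=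
  (forall n, F n != fset0) /\
  forall K : {fset G}, K != fset0 ->
    (fun n => let KF := [fset (k * g)%g | k in K, g in F n]%fset in
       #|` ((KF `\` F n) `|` (F n `\` KF))%fset|%:R / #|` F n|%:R : R)
      @ \oo --> (0 : R).

Section Entropy.
Variables (R : realType) (G : monoidType) (X : pmetricType R).
Variable T : G -> X -> X.

Definition continuous_action : Prop :=
  [/\ forall g, continuous (T g),
      forall u, T 1%g u = u
    & forall g h u, T (g * h)%g u = T g (T h u)].

Definition invariant_measure (mu : probability (borel X) R) : Prop :=
  forall (g : G) (A : set (borel X)), measurable A -> mu (T g @^-1` A) = mu A.

(* Empty cells are allowed; they do not contribute to the entropy. *)
Definition measurable_partition (I : finType) (P : I -> set (borel X)) : Prop :=
  [/\ forall i, measurable (P i), trivIset setT P & \bigcup_i P i = setT].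

(* [0 * ln 0 = 0], so null cells contribute 0. *)
Definition shannon_entropy (mu : probability (borel X) R)
    (I : finType) (P : I -> set (borel X)) : R :=
  - \sum_i fine (mu (P i)) * ln (fine (mu (P i))).

Definition refined_partition (F : {fset G}) (I : finType)
    (P : I -> set (borel X)) : {ffun F -> I} -> set (borel X) :=
  fun w => \bigcap_(g : F) T (val g) @^-1` P (w g).

(* For [G = posnat] the sequence below converges whenever [F] is Folner and [mu]
   is invariant; the upper limit is used because [limn] has a junk value on
   divergent sequences. *)
Definition partition_entropy (F : nat -> {fset G})
    (mu : probability (borel X) R) (I : finType) (P : I -> set (borel X)) :
    \bar R :=
  limn_esup (fun n =>
    (shannon_entropy mu (refined_partition (F := F n) P) / #|` F n|%:R)%:E).

Definition measure_entropy (F : nat -> {fset G})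
    (mu : probability (borel X) R) : \bar R :=
  ereal_sup [set h | exists (k : nat) (P : 'I_k -> set (borel X)),
    measurable_partition P /\ h = partition_entropy F mu P].

Definition topological_entropy (F : nat -> {fset G}) : \bar R :=
  ereal_sup [set measure_entropy F mu | mu in [set mu | invariant_measure mu]].

End Entropy.

(* For [G = posnat] Folner sequences exist and the entropy is the same along all
   of them. *)
Definition strongly_deterministic (R : realType) (G : monoidType) (f : G -> R) :
    Prop :=
  exists (X : pmetricType R) (T : G -> X -> X) (phi : X -> R) (x0 : X),
    [/\ compact [set: X],
        continuous_action T,
        forall F : nat -> {fset G}, folner R F -> topological_entropy T F = 0%E,
        continuous phi
      & forall g, f g = phi (T g x0)].

(* Main.v *)
Require Import Defs.
From HB Require Import structures.
From mathcomp Require Import all_boot all_order all_algebra monoid finmap.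
From mathcomp Require Import all_classical all_reals all_analysis.
From mathcomp Require Import ring.

Set Implicit Arguments.
Unset Strict Implicit.
Unset Printing Implicit Defensive.
Import Order.TTheory GRing.Theory Num.Theory.
Import numFieldNormedType.Exports.

Local Open Scope classical_set_scope.
Local Open Scope ring_scope.

(** The exponent word of [N] is the word of the odd part of [N] followed by the
    word of its 2-part.  Hence [x N = omega (a (s0'))], where the map
    [a : S -> S] depends only on the 2-part of [N] and the state [s0'] only on
    its odd part.  This alone forces zero entropy, because each of the two parts
    ignores a whole direction of the semigroup: the 2-part is unchanged when [N]
    is multiplied by 3, the odd part when [N] is multiplied by 2.

    The system.  Let [V] be the finite set of maps [S -> S] and let [X] be the
    compact space of all functions [u : posnat * bool -> V].  An element [g] acts
    by [(g u)(h, d) = u (h * g_d, d)], where [g_true] is the 2-part of [g] and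
    [g_false] its odd part.  The point [x0] sending [(h, d)] to the transition map
    of the word of [h], read through
    [phi u = omega (u (1, true) (u (1, false) s0))], represents [x].

    Entropy is at most zero.  Let [mu] be invariant, [P] a finite Borel partition
    and [F] a finite set.  Approximating the cells of [P] by cylinders gives a
    partition [Q] depending on finitely many coordinates and differing from [P] on
    a set of measure at most [eta] ([cylinder_partition]).  The [Q]-names over [F]
    depend only on the coordinates of [u] at the [(h * g_d, d)] with [g] in [F]
    and [(h, d)] in a finite window.  If [q] does not affect [g_d], every value
    of [g_d] on [F] is also taken on [q F \ F] (multiply by [q] until one leaves
    [F]), so along a Folner sequence there are [o(|F|)] such coordinates
    ([folner_invariant_image]) and the number of [Q]-names is [exp (o(|F|))]
    ([card_names]).

    The passage from [Q] back to [P] is a coding argument.  By Gibbs'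
    inequality the entropy of the [P]-names is at most their expected code length
    for any probability vector.  The vector used picks a [Q]-name uniformly and
    perturbs each letter with probability about [delta]; by invariance the
    expected number of letters in which the two names of a point differ is at most
    [eta |F|], so the code length is at most
    [ln #names + |F| (- ln (1 - delta) + eta ln (k / delta))]
    ([entropy_le_hamming]).  It remains to choose [delta] small, then [eta] small
    depending on [delta], and to let [F] run along a Folner sequence.

    Entropy is at least zero because an invariant measure exists: the Dirac mass
    at a constant function, which is a fixed point of the action. *)

(** * Entropy of words close to a small set of words *)

Section FiniteEntropy.
Variable R : realType.

(** Termwise [p (ln q - ln p) <= q - p], by concavity of the logarithm; [p] may
    vanish, in which case the term is [0 <= q]. *)
Lemma gibbs_inequality (W : finType) (p q : W -> R) :
  (forall w, 0 <= p w) -> (forall w, 0 < q w) ->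
  \sum_w q w <= \sum_w p w ->
  - (\sum_w p w * ln (p w)) <= - (\sum_w p w * ln (q w)).
Proof.
move=> p0 q0 qp.
suff : \sum_w (p w * ln (q w) - p w * ln (p w)) <= \sum_w (q w - p w).
  rewrite !sumrB lerN2 => h; rewrite -subr_le0; apply: le_trans h _.
  by rewrite subr_le0.
apply: ler_sum => w _.
have [->|pw0] := eqVneq (p w) 0; first by rewrite !mul0r !subr0 ltW.
have {}pw0 : 0 < p w by rewrite lt_neqAle eq_sym pw0 p0.
rewrite -mulrBr -ln_div ?posrE //.
have := @le_ln1Dx R (q w / p w - 1).
rewrite addrCA subrr addr0 ltrBrDl subrr divr_gt0// => /(_ isT) h.
rewrite (le_trans (ler_wpM2l (ltW pw0) h))// mulrBr mulr1 mulrCA divff ?gt_eqF//.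
by rewrite mulr1.
Qed.

Section HammingBound.
Variables (J A : finType) (N : {set {ffun J -> A}}) (d : R).
Hypotheses (A0 : (0 < #|A|)%N) (d0 : 0 < d) (d1 : d < 1).

(** A channel on letters that erases with probability [d] and then draws a letter
    uniformly: every transition has positive probability, so logarithms of its
    values are bounded. *)
Definition noise (a b : A) : R := (1 - d) * (a == b)%:R + d / #|A|%:R.

Lemma noise_gt0 a b : 0 < noise a b.
Proof.
rewrite /noise ltr_wpDl ?divr_gt0 ?ltr0n// mulr_ge0// subr_ge0 ltW //.
Qed.

Lemma noise_sum a : \sum_b noise a b = 1.
Proof.
rewrite /noise big_split/= -mulr_sumr (bigD1 a)//= eqxx big1 => [|b]; last first.
  by rewrite eq_sym => /negPf ->.
rewrite addr0 mulr1 sumr_const -[X in _ + X]mulr_natr -mulrA mulVf ?mulr1 ?subrK//.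
by rewrite pnatr_eq0 -lt0n.
Qed.

Lemma ln_noise a b :
  - ln (noise a b) <= - ln (1 - d) + (a != b)%:R * ln (#|A|%:R / d).
Proof.
have cA : 0 < #|A|%:R :> R by rewrite ltr0n.
have [->|ab] /= := eqVneq a b.
  rewrite mul0r addr0 lerN2 ler_ln ?posrE ?noise_gt0 ?subr_gt0// /noise eqxx mulr1.
  by rewrite lerDl divr_ge0// ltW.
rewrite mul1r /noise (negPf ab) mulr0 add0r -lnV ?posrE ?divr_gt0// invf_div.
by rewrite lerDr oppr_ge0 ln_le0// gerBl ltW.
Qed.

(** The law of the output of the channel when a word of [N], drawn uniformly, is
    sent through it letter by letter. *)
Definition noisy_mixture (w : {ffun J -> A}) : R :=
  #|N|%:R^-1 * \sum_(u in N) \prod_j noise (u j) (w j).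

Lemma noisy_mixture_sum : (0 < #|N|)%N -> \sum_w noisy_mixture w = 1.
Proof.
move=> N0; rewrite -mulr_sumr exchange_big/=.
under eq_bigr => u _.
  rewrite -(bigA_distr_bigA (fun j b => noise (u j) b))/=.
  under eq_bigr do rewrite noise_sum.
  rewrite big1//.
  over.
by rewrite sumr_const -mulr_natl mulr1 mulVf// pnatr_eq0 -lt0n.
Qed.

(** The mixture is at least its [u]-th summand, and each letter where [u] and [w]
    agree, respectively differ, costs the bound of [ln_noise]. *)
Lemma ln_noisy_mixture u w : u \in N ->
  - ln (noisy_mixture w) <= ln #|N|%:R +
    \sum_j (- ln (1 - d) + (u j != w j)%:R * ln (#|A|%:R / d)).
Proof.
move=> uN.
have N0 : 0 < #|N|%:R :> R by rewrite ltr0n; apply/card_gt0P; exists u.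
have prod_gt0 (v : {ffun J -> A}) : 0 < \prod_j noise (v j) (w j).
  by apply: prodr_gt0 => j _; exact: noise_gt0.
have ge : #|N|%:R^-1 * \prod_j noise (u j) (w j) <= noisy_mixture w.
  rewrite ler_wpM2l ?invr_ge0 ?(ltW N0)// [leRHS](bigD1 u)//= lerDl.
  by apply: sumr_ge0 => v _; exact: ltW.
have gt : 0 < #|N|%:R^-1 * \prod_j noise (u j) (w j) by rewrite mulr_gt0 ?invr_gt0.
have : - ln (noisy_mixture w) <= - ln (#|N|%:R^-1 * \prod_j noise (u j) (w j)).
  by rewrite lerN2 ler_ln ?posrE// (lt_le_trans gt).
move/le_trans; apply; rewrite lnM ?posrE ?invr_gt0// opprD lnV ?posrE// opprK lerD2l.
suff -> : ln (\prod_j noise (u j) (w j)) = \sum_j ln (noise (u j) (w j)).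
  by rewrite -sumrN ler_sum// => j _; exact: ln_noise.
have : forall s : seq J, 0 < \prod_(j <- s) noise (u j) (w j) /\
  ln (\prod_(j <- s) noise (u j) (w j)) = \sum_(j <- s) ln (noise (u j) (w j)).
  elim=> [|j s [IH0 IH]]; first by rewrite !big_nil ln1.
  by rewrite !big_cons lnM ?posrE ?noise_gt0// IH mulr_gt0// noise_gt0.
by move=> h; have [_] := h (index_enum J).
Qed.

(** Here [r] is a joint law of two words, the second of which lies in [N] almost
    surely, and [eta] bounds the probability of disagreement at each letter.  The
    first word is coded by the noisy mixture over [N], and the code length is
    averaged over [r] by means of [ln_noisy_mixture]. *)
Lemma entropy_le_hamming (r : {ffun J -> A} * {ffun J -> A} -> R) (eta : R) :
  (forall z, 0 <= r z) -> \sum_z r z = 1 ->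
  (forall z : {ffun J -> A} * {ffun J -> A}, z.2 \notin N -> r z = 0) ->
  (forall j, \sum_(z : {ffun J -> A} * {ffun J -> A} | z.2 j != z.1 j) r z
     <= eta) ->
  - (\sum_w (\sum_u r (w, u)) * ln (\sum_u r (w, u))) <=
    ln #|N|%:R + #|J|%:R * (- ln (1 - d) + eta * ln (#|A|%:R / d)).
Proof.
move=> r0 r1 rN reta.
have [z0 z0N] : exists z : {ffun J -> A} * {ffun J -> A}, z.2 \in N.
  apply: contrapT => /forallNP nz; move: r1; rewrite big1 => [|z _].
    by move/eqP; rewrite eq_sym oner_eq0.
  by apply: rN; apply/negP; exact: nz.
have N0 : (0 < #|N|)%N by apply/card_gt0P; exists z0.2.
have lnA : 0 <= ln (#|A|%:R / d).
  apply: ln_ge0; rewrite ler_pdivlMr// mul1r (le_trans (ltW d1))//.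
  by rewrite ler1n.
have mix_gt0 w : 0 < noisy_mixture w.
  rewrite /noisy_mixture mulr_gt0 ?invr_gt0 ?ltr0n// (bigD1 z0.2)//=.
  rewrite ltr_pwDl//; first by apply: prodr_gt0 => j _; exact: noise_gt0.
  by apply: sumr_ge0 => u _; apply: prodr_ge0 => j _; exact/ltW/noise_gt0.
have rpair : \sum_w \sum_u r (w, u) = 1.
  by rewrite pair_bigA -r1; apply: eq_bigr => -[].
apply: le_trans (gibbs_inequality _ mix_gt0 _) _.
- by move=> w; exact: sumr_ge0.
- by rewrite noisy_mixture_sum// rpair.
rewrite -sumrN; under eq_bigr do rewrite -mulrN mulr_suml.
rewrite pair_bigA/=.
set c := - ln (1 - d); set b := ln (#|A|%:R / d).
have step (z : {ffun J -> A} * {ffun J -> A}) :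
    r (z.1, z.2) * - ln (noisy_mixture z.1) <=
    r z * ln #|N|%:R + \sum_j (r z * c + (z.2 j != z.1 j)%:R * r z * b).
  rewrite -surjective_pairing.
  have [zN|/rN ->] := boolP (z.2 \in N); last first.
    by rewrite mul0r [X in X + _]mul0r add0r big1// => j _; rewrite !(mulr0, mul0r) addr0.
  apply: le_trans (ler_wpM2l (r0 z) (ln_noisy_mixture z.1 zN)) _.
  rewrite mulrDr lerD2l mulr_sumr le_eqVlt; apply/orP; left; apply/eqP.
  by apply: eq_bigr => j _; rewrite mulrDr mulrCA mulrA.
apply: le_trans (ler_sum _ (fun z _ => step z)) _.
rewrite big_split/= -mulr_suml r1 mul1r lerD2l exchange_big/=.
rewrite mulr_natl -sumr_const ler_sum// => j _.
rewrite big_split/= -!mulr_suml r1 mul1r lerD2l ler_wpM2r//.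
apply: le_trans (reta j); rewrite [leRHS]big_mkcond/=.
by apply: ler_sum => z _; case: ifP; rewrite ?mul1r ?mul0r.
Qed.

End HammingBound.
End FiniteEntropy.

(** * The space of functions from a countable set to a finite set *)

(** The parameters [R] and [v0] do not occur in the body: they let the metric
    with values in [R] and the base point be inferred from the type. *)
Definition symbolic (R : realType) (I : countType) (V : finType) (v0 : V) :=
  I -> V.

Section SymbolicMetric.
Variables (R : realType) (I : countType) (V : finType) (v0 : V).
Local Notation X := (symbolic R I v0).
Implicit Types u v w : X.

HB.instance Definition _ := gen_eqMixin X.
HB.instance Definition _ := gen_choiceMixin X.
HB.instance Definition _ := isPointed.Build X (fun=> v0).

Definition agree n u v := forall i : I, (choice.pickle i < n)%N -> u i = v i.

Lemma agreexx n u : agree n u u. Proof. by []. Qed.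

Lemma agree_sym n u v : agree n u v -> agree n v u.
Proof. by move=> uv i /uv. Qed.

Lemma agree_trans n u v w : agree n u v -> agree n v w -> agree n u w.
Proof. by move=> uv vw i ni; rewrite uv// vw. Qed.

Lemma agree_le m n u v : (m <= n)%N -> agree n u v -> agree m u v.
Proof. by move=> mn uv i im; apply: uv; exact: leq_trans mn. Qed.

(** The balls of this ultrametric are the agreement classes; any decreasing null
    sequence could replace [1 / (n + 1)]. *)
Definition symbolic_dist u v : R :=
  inf [set (n.+1%:R^-1 : R) | n in [set n | agree n u v]].

Let has_inf_dist u v :
  has_inf [set (n.+1%:R^-1 : R) | n in [set n | agree n u v]].
Proof.
split; first by exists 1, 0%N => //=; rewrite invr1.
by exists 0 => _ [n _ <-]; rewrite invr_ge0.
Qed.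

Lemma symbolic_dist_le n u v : agree n u v -> symbolic_dist u v <= n.+1%:R^-1.
Proof. by move=> uv; apply: ge_inf; [case: (has_inf_dist u v)|exists n]. Qed.

Lemma symbolic_dist_lt e u v : symbolic_dist u v < e ->
  exists2 n, agree n u v & n.+1%:R^-1 < e.
Proof.
by move=> /(inf_lt (has_inf_dist u v).1)[_ [n uv <-] ne]; exists n.
Qed.

Lemma symbolic_dist_agree n u v : symbolic_dist u v < n.+1%:R^-1 -> agree n u v.
Proof.
move=> /symbolic_dist_lt[m uv]; rewrite ltf_pV2 ?posrE// ltr_nat ltnS => nm.
exact: agree_le (ltnW nm) uv.
Qed.

Lemma symbolic_dist_ge0 u v : 0 <= symbolic_dist u v.
Proof.
apply: lb_le_inf => [|_ [n _ <-]]; first by case: (has_inf_dist u v).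
by rewrite invr_ge0.
Qed.

Lemma small_invS (e : R) : 0 < e -> exists n : nat, n.+1%:R^-1 < e.
Proof.
move=> e0; have [n _ /(_ n (leqnn n))] := near_infty_natSinv_lt (PosNum e0).
by exists n.
Qed.

Lemma symbolic_distxx u : symbolic_dist u u = 0.
Proof.
apply/eqP; rewrite eq_le symbolic_dist_ge0 andbT; apply/ler_addgt0Pl => e e0.
have [n ne] := small_invS e0; rewrite addr0.
by apply: le_trans (ltW ne); exact: symbolic_dist_le.
Qed.

Lemma symbolic_dist_positivity u v : symbolic_dist u v = 0 -> u = v.
Proof.
move=> uv; apply/funext => i.
apply: (@symbolic_dist_agree (choice.pickle i).+1 u v) => //.
by rewrite uv invr_gt0.
Qed.

Lemma symbolic_dist_sym u v : symbolic_dist u v = symbolic_dist v u.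
Proof.
congr inf; congr image; apply/seteqP.
by split=> n; exact: agree_sym.
Qed.

Lemma symbolic_dist_triangle v u w :
  symbolic_dist u w <= symbolic_dist u v + symbolic_dist v w.
Proof.
apply/ler_addgt0Pr => e e0.
have lt (x y : X) : symbolic_dist x y < symbolic_dist x y + e by rewrite ltrDl.
have [m uv me] := symbolic_dist_lt (lt u v).
have [n vw ne] := symbolic_dist_lt (lt v w).
have [mn|nm] := leqP m n.
  have uw := agree_trans uv (agree_le mn vw).
  rewrite (le_trans (symbolic_dist_le uw))// (le_trans (ltW me))//.
  by rewrite addrAC lerDl symbolic_dist_ge0.
have uw := agree_trans (agree_le (ltnW nm) uv) vw.
rewrite (le_trans (symbolic_dist_le uw))// (le_trans (ltW ne))//.
by rewrite -addrA lerDr symbolic_dist_ge0.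
Qed.

HB.instance Definition _ := @isMetric.Build R X symbolic_dist symbolic_distxx
  symbolic_dist_positivity symbolic_dist_sym symbolic_dist_triangle.

Lemma nbhs_symbolic u (A : set X) :
  nbhs u A <-> exists n, forall v, agree n u v -> A v.
Proof.
split=> [/nbhs_ballP[e /= e0 eA]|[n nA]].
  have [n ne] := small_invS e0; exists n => v uv; apply: eA.
  by rewrite ballEmdist/=; apply: le_lt_trans ne; exact: symbolic_dist_le.
apply/nbhs_ballP; exists n.+1%:R^-1 => /=; first by rewrite invr_gt0.
by move=> v; rewrite ballEmdist => /symbolic_dist_agree/nA.
Qed.

(** An ultrafilter selects one value at each coordinate, because there are finitely
    many values; it converges to the function so obtained, because a neighbourhood
    constrains finitely many coordinates. *)
Lemma symbolic_compact : compact [set: X].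
Proof.
rewrite compact_ultra => F FU _.
have FF : ProperFilter F by exact: ultra_proper.
have ex_limit i : exists a : V, F [set u : X | u i = a].
  apply: contrapT => /forallNP nF; apply: (@filter_not_empty _ F).
  have : F (fun u : X => forall a : V, u i <> a).
    apply: filter_forall => a.
    by case: (in_ultra_setVsetC [set u : X | u i = a] FU) => // /nF.
  by apply: filterS => u /(_ (u i)).
have [p Fp] := choice ex_limit; exists p; split=> // A /nbhs_symbolic[n pA].
have : F (fun u : X =>
    forall (k : 'I_n) (i : I), choice.pickle i = k -> p i = u i).
  apply: filter_forall => k.
  have [[i ik]|nk] := pselect (exists i : I, choice.pickle i = k); last first.
    by apply: filterE => u i ik; case: nk; exists i.
  apply: filterS (Fp i) => u /= ui j jk.
  by rewrite (_ : j = i) ?ui//; apply: (pcan_inj choice.pickleK); rewrite ik jk.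
by apply: filterS => u pu; apply: pA => i ni; exact: (pu (Ordinal ni)).
Qed.
End SymbolicMetric.

(** * Finite-valued measurable maps on a probability space *)

Section FiniteValued.
Variables (R : realType) (d : measure_display) (T : measurableType d).
Variable mu : probability T R.
Local Notation m A := (fine (mu A)).

Lemma fine_probabilityK (A : set T) : measurable A -> (m A)%:E = mu A.
Proof. by move=> mA; rewrite fineK// fin_num_measure. Qed.

Lemma fine_probability_le (A B : set T) : measurable A -> measurable B ->
  A `<=` B -> m A <= m B.
Proof.
move=> mA mB AB; rewrite -lee_fin !fine_probabilityK//.
by apply: le_measure; rewrite ?inE.
Qed.

Lemma fine_probabilityU_le (A B : set T) : measurable A -> measurable B ->
  m (A `|` B) <= m A + m B.
Proof.
move=> mA mB; rewrite -lee_fin EFinD !fine_probabilityK//; last exact: measurableU.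
exact: measureU2.
Qed.

(** Continuity from above, applied to the differences, whose intersection is
    empty. *)
Lemma probability_bigcupD_small (F : (set T)^nat) (e : R) : 0 < e ->
  (forall n, measurable (F n)) -> {homo F : m n / (m <= n)%N >-> m `<=` n} ->
  exists n, m (\bigcup_k F k `\` F n) < e.
Proof.
move=> e0 mF ndF; have mUF : measurable (\bigcup_k F k) by exact: bigcup_measurable.
have mD n : measurable (\bigcup_k F k `\` F n) by exact: measurableD.
have D0 : \bigcap_n (\bigcup_k F k `\` F n) = set0.
  rewrite -subset0 => t tD; have [[k _ Fk] _] := tD 0%N I.
  by have [_] := tD k I.
have : mu (\bigcup_k F k `\` F n) @[n --> \oo] --> mu set0.
  rewrite -D0; apply: nonincreasing_cvg_mu => //.
  - by rewrite ltey_eq fin_num_measure.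
  - by rewrite D0.
  - move=> i j ij; apply/subsetPset => t [tU nFj]; split=> //.
    by apply: contra_not nFj; exact: ndF.
rewrite measure0 => /fine_cvgP[_] /cvgrPdist_lt/(_ e e0)[n _ /(_ n (leqnn n))] /=.
by rewrite sub0r normrN ger0_norm ?fine_ge0//; exists n.
Qed.

Definition measurable_fibers (E : Type) (Z : T -> E) :=
  forall e, measurable (Z @^-1` [set e]).

Lemma measurable_fibers_preimage (E : finType) (Z : T -> E) (B : set E) :
  measurable_fibers Z -> measurable (Z @^-1` B).
Proof.
move=> mZ; rewrite (_ : _ @^-1` _ = \bigcup_(e in B) (Z @^-1` [set e])).
  by apply: fin_bigcup_measurable => //; exact: finite_finset.
by apply/seteqP; split=> [t Bt|t [e Be] /= ->//]; exists (Z t).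
Qed.

Lemma measurable_fibers_pair (E E' : finType) (Z : T -> E) (Z' : T -> E') :
  measurable_fibers Z -> measurable_fibers Z' ->
  measurable_fibers (fun t => (Z t, Z' t)).
Proof.
move=> mZ mZ' [e e']; rewrite (_ : _ @^-1` _ =
  Z @^-1` [set e] `&` Z' @^-1` [set e']); first exact: measurableI.
by apply/seteqP; split=> t /= [-> ->].
Qed.

Lemma measurable_fibers_ffun (J E : finType) (Z : J -> T -> E) :
  (forall j, measurable_fibers (Z j)) ->
  measurable_fibers (fun t => [ffun j => Z j t]).
Proof.
move=> mZ w; rewrite (_ : _ @^-1` _ = \bigcap_(j : J) (Z j @^-1` [set w j])).
  by apply: fin_bigcap_measurable => // j _; exact: mZ.
apply/seteqP; split=> [t <- j _ /=|t tw /=]; first by rewrite ffunE.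
by apply/ffunP => j; rewrite ffunE; exact: tw.
Qed.

Lemma probability_preimage_sum (E : finType) (Z : T -> E) (B : pred E) :
  measurable_fibers Z ->
  m (Z @^-1` [set e | B e]) = \sum_(e | B e) m (Z @^-1` [set e]).
Proof.
move=> mZ; apply: EFin_inj; rewrite fine_probabilityK; last first.
  exact: measurable_fibers_preimage.
rewrite (_ : _ @^-1` _ = \bigcup_(e in [set e | B e]) (Z @^-1` [set e])); last first.
  by apply/seteqP; split=> [t Bt|t [e Be] /= ->//]; exists (Z t).
rewrite measure_fin_bigcup//; first last.
- by apply/trivIsetP => i j _ _ ij; rewrite -subset0 => t /= [ti tj];
  move: ij; rewrite -ti -tj eqxx.
- exact: finite_finset.
rewrite -sumEFin (bigfs _ (index_enum_uniq E)); last first.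
  by move=> e _; rewrite mem_index_enum.
by apply: eq_fsbigr => e _; rewrite /= fine_probabilityK.
Qed.

End FiniteValued.

(** * Approximation of Borel partitions by cylinder partitions *)

Section CylinderApproximation.
Variables (R : realType) (I : countType) (V : finType) (v0 : V).
Local Notation X := (symbolic R I v0).
Variable mu : probability (borel X) R.
Local Notation m A := (fine (mu A)).

Definition cylinder n (C : set X) := forall u v : X, agree n u v -> C u -> C v.

Lemma cylinder_le k n (C : set X) : (k <= n)%N -> cylinder k C -> cylinder n C.
Proof. by move=> kn kC u v uv; apply: kC; exact: agree_le uv. Qed.

Lemma cylinder_measurable n (C : set X) :
  cylinder n C -> measurable (C : set (borel X)).
Proof.
move=> nC; apply: sub_sigma_algebra; rewrite openE => u Cu.
by apply/nbhs_symbolic; exists n => v uv; exact: nC Cu.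
Qed.

(** Measurability is part of the definition so that the sets with this property
    form a sigma-algebra on the nose. *)
Definition approximable (A : set (borel X)) := measurable A /\
  forall e, 0 < e -> exists n (C : set X), cylinder n C /\ m (A `+` C) < e.

Lemma measurable_setY (A B : set (borel X)) :
  measurable A -> measurable B -> measurable (A `+` B).
Proof. by move=> mA mB; apply: measurableU; exact: measurableD. Qed.

Lemma approximable_cylinder n (C : set X) : cylinder n C -> approximable C.
Proof.
move=> nC; split; first exact: cylinder_measurable nC.
by move=> e e0; exists n, C; split => //; rewrite /setY setDv setU0 measure0.
Qed.

Lemma approximableC (A : set (borel X)) : approximable A -> approximable (~` A).
Proof.
move=> [mA aA]; split; first exact: measurableC.
move=> e e0; have [n [C [nC Ce]]] := aA _ e0; exists n, (~` C); split.
  by move=> u v uv; apply: contra_not => /(nC _ _ (agree_sym uv)).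
rewrite (_ : _ `+` _ = A `+` C)//; apply/seteqP; rewrite /setY.
by split=> t /=; have [] := pselect (A t); have [] := pselect (C t); tauto.
Qed.

Lemma approximableU (A B : set (borel X)) :
  approximable A -> approximable B -> approximable (A `|` B).
Proof.
move=> [mA aA] [mB aB]; split; first exact: measurableU.
move=> e e0; have e20 : 0 < e / 2 by rewrite divr_gt0.
have [k [C [kC Ce]]] := aA _ e20; have [l [D [lD De]]] := aB _ e20.
have mC := cylinder_measurable kC; have mD := cylinder_measurable lD.
exists (maxn k l), (C `|` D); split.
  have kCD := cylinder_le (leq_maxl k l) kC.
  have lCD := cylinder_le (leq_maxr k l) lD.
  by move=> u v uv [Cu|Du]; [left; exact: kCD Cu|right; exact: lCD Du].
have mAC := measurable_setY mA mC; have mBD := measurable_setY mB mD.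
apply: (@le_lt_trans _ _ (m ((A `+` C) `|` (B `+` D)))).
  apply: fine_probability_le.
  - by apply: measurable_setY; exact: measurableU.
  - exact: measurableU.
  - move=> t; rewrite /setY /=.
    by have [] := pselect (A t); have [] := pselect (B t);
      have [] := pselect (C t); have [] := pselect (D t); tauto.
apply: le_lt_trans (fine_probabilityU_le _ mAC mBD) _.
by rewrite (splitr e) ltrD.
Qed.

Lemma approximable_nondecreasing_bigcup (F : (set (borel X))^nat) :
  (forall n, approximable (F n)) -> {homo F : m n / (m <= n)%N >-> m `<=` n} ->
  approximable (\bigcup_n F n).
Proof.
move=> aF ndF; have mF n : measurable (F n) by case: (aF n).
have mU : measurable (\bigcup_n F n) by exact: bigcup_measurable.
split=> // e e0; have e20 : 0 < e / 2 by rewrite divr_gt0.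
have [k ke] := probability_bigcupD_small mu e20 mF ndF.
have [n [C [nC Ce]]] := (aF k).2 _ e20.
have mC := cylinder_measurable nC; exists n, C; split=> //.
have mD := measurableD mU (mF k); have mFC := measurable_setY (mF k) mC.
apply: (@le_lt_trans _ _ (m ((\bigcup_n F n `\` F k) `|` (F k `+` C)))).
  apply: fine_probability_le.
  - exact: measurable_setY.
  - exact: measurableU.
  - move=> t; rewrite /setY; have FU : F k t -> (\bigcup_n F n) t by exists k.
    by move: FU => /=; have [] := pselect (F k t); have [] := pselect (C t); tauto.
apply: le_lt_trans (fine_probabilityU_le _ mD mFC) _.
by rewrite (splitr e) ltrD.
Qed.

(** The points whose agreement class of level [n] is contained in [A] form a
    cylinder, and these cylinders increase to [A]. *)
Lemma approximable_open (A : set X) : open A -> approximable A.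
Proof.
rewrite openE => oA.
pose D n := [set u : X | forall v, agree n u v -> A v].
rewrite (_ : A = \bigcup_n D n).
  apply: (@approximable_nondecreasing_bigcup D) => [n|k n kn u Du v uv].
    apply: (@approximable_cylinder n) => u v uv Du w vw; apply: Du.
    exact: agree_trans vw.
  by apply: Du; exact: agree_le uv.
apply/seteqP; split=> [u /oA/nbhs_symbolic[n nA]|u [n _ Du]]; first by exists n.
exact/Du/agreexx.
Qed.

Lemma measurable_approximable (A : set (borel X)) :
  measurable A -> approximable A.
Proof.
apply: smallest_sub => [|B]; last exact: approximable_open.
split.
- exact: (@approximable_cylinder 0%N).
- by move=> B aB; rewrite setTD; exact: approximableC.
- move=> F aF; rewrite -bigcup_bigsetU_bigcup.
  apply: approximable_nondecreasing_bigcup => [n|k n kn]; last first.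
    exact: subset_bigsetU.
  elim: n => [|n IH]; last by rewrite big_ord_recr; exact: approximableU.
  by rewrite big_ord1.
Qed.

(** Each cell of [P] is approximated within [e / k].  A point outside the [k]
    symmetric differences lies in exactly one of the approximating cylinders, the
    one attached to its cell, so the first cylinder containing it is the right
    one. *)
Lemma cylinder_partition k (P : borel X -> 'I_k) (e : R) :
  measurable_fibers P -> 0 < e -> exists n (Q : X -> 'I_k),
    (forall u v, agree n u v -> Q u = Q v) /\
    m [set u | Q u != P u] <= e.
Proof.
move=> mP e0.
have k0 : (0 < k)%N by exact: leq_ltn_trans (ltn_ord (P point)).
have ek0 : 0 < e / k%:R by rewrite divr_gt0// ltr0n.
have : forall i, exists nC : nat * set X, cylinder nC.1 nC.2 /\
    m ((P @^-1` [set i]) `+` nC.2) < e / k%:R.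
  move=> i; have [_ /(_ _ ek0)[n [C [nC Ce]]]] := measurable_approximable (mP i).
  by exists (n, C).
move=> /choice[D DP].
pose Q (u : X) := odflt (P point) [pick i | `[< (D i).2 u >]].
pose n := \max_(i < k) (D i).1.
have nD i : cylinder n (D i).2 by apply: cylinder_le (DP i).1; exact: leq_bigmax.
have nQ u v : agree n u v -> Q u = Q v.
  move=> uv; congr odflt; apply: eq_pick => i.
  by apply/asboolP/asboolP; apply: nD => //; exact: agree_sym.
exists n, Q; split => //.
have mE i : measurable ((P @^-1` [set i] : set (borel X)) `+` (D i).2).
  exact: measurable_setY (mP i) (cylinder_measurable (DP i).1).
have QP : [set u | Q u != P u] `<=`
    \big[setU/set0]_(i < k) ((P @^-1` [set i] : set (borel X)) `+` (D i).2).
  move=> u /= QPu; apply: contrapT; rewrite -bigcup_seq => nE; move: QPu.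
  have DE i : (D i).2 u <-> P u = i.
    apply: contrapT => nD'; apply: nE; exists i => /=; first exact: mem_index_enum.
    rewrite /setY /=; move: nD'.
    by have [] := pselect (P u = i); have [] := pselect ((D i).2 u); tauto.
  rewrite /Q; case: pickP => [i /asboolP/DE ->|/(_ (P u))/asboolP[]].
    by rewrite eqxx.
  exact/DE.
have mU : measurable (\big[setU/set0]_(i < k)
  ((P @^-1` [set i] : set (borel X)) `+` (D i).2)) by exact: bigsetU_measurable.
have mQ : measurable_fibers (Q : borel X -> 'I_k).
  by move=> i; apply: (@cylinder_measurable n) => u v /nQ /= ->.
have mQP : measurable [set u : borel X | Q u != P u].
  exact: (measurable_fibers_preimage [set z | z.1 != z.2]
    (measurable_fibers_pair mQ mP)).
apply: le_trans (fine_probability_le mu mQP mU QP) _.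
have : forall s : seq 'I_k, m (\big[setU/set0]_(i <- s)
  ((P @^-1` [set i] : set (borel X)) `+` (D i).2)) <= \sum_(i <- s) e / k%:R.
  elim=> [|i s IH]; first by rewrite !big_nil measure0.
  rewrite !big_cons; apply: le_trans (fine_probabilityU_le _ _ _) _ => //.
    exact: bigsetU_measurable.
  by rewrite lerD// ltW// (DP i).2.
move=> /(_ (index_enum 'I_k))/le_trans; apply.
by rewrite sumr_const card_ord -[leLHS]mulr_natr divfK// pnatr_eq0 -lt0n.
Qed.

End CylinderApproximation.

(** * Entropy of an action by relabelling of coordinates *)

Section Reindexing.
Variables (R : realType) (I : countType) (V : finType) (v0 : V).
Variables (G : monoidType) (tau : G -> I -> I).
Local Notation X := (symbolic R I v0).

Definition relabel (g : G) (u : X) : X := fun i => u (tau g i).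

(** The indices below level [n]; codes that [unpickle] rejects are skipped. *)
Definition window n : seq I := pmap choice.unpickle (iota 0 n).

Lemma mem_window n i : (choice.pickle i < n)%N -> i \in window n.
Proof.
move=> ni; rewrite mem_pmap; apply/mapP; exists (choice.pickle i).
  by rewrite mem_iota.
by rewrite choice.pickleK.
Qed.

Lemma relabel_continuous g : continuous (relabel g).
Proof.
move=> u A /nbhs_symbolic[n nA]; apply/nbhs_symbolic.
exists (\max_(i <- window n) (choice.pickle (tau g i)).+1) => v uv; apply: nA => i ni.
apply: uv; apply: (@leq_bigmax_seq _ (window n) xpredT) => //.
exact: mem_window.
Qed.

Lemma relabel_measurable g (A : set (borel X)) :
  measurable A -> measurable (relabel g @^-1` A : set (borel X)).
Proof.
apply: (@smallest_sub _ (sigma_algebra setT)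
  (@open X) [set A : set X | measurable (relabel g @^-1` A : set (borel X))]).
- split=> [|B mB|F mF] /=; first by rewrite preimage_set0.
    by rewrite setTD preimage_setC; exact: measurableC.
  by rewrite preimage_bigcup; apply: bigcupT_measurable => k; exact: mF.
- move=> B oB; apply: sub_sigma_algebra.
  by apply: open_comp => // u _; exact: relabel_continuous.
Qed.

(** The number of coordinates that the elements of [F] bring to position [i]; it
    controls the complexity of the action along [F]. *)
Definition spread (F : {fset G}) i : nat := #|` [fset tau g i | g in F]%fset|.

Section Names.
Variables (F : {fset G}) (k : nat).

Definition name (Q : X -> 'I_k) (u : X) : {ffun F -> 'I_k} :=
  [ffun g : F => Q (relabel (val g) u)].

(** The names are decoded from the list of values of [u] at the coordinates
    [tau g i] with [g] in [F] and [i] in the window. *)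
Lemma card_names n (Q : X -> 'I_k) :
  (forall u v, agree n u v -> Q u = Q v) ->
  exists N : {set {ffun F -> 'I_k}}, (forall u, name Q u \in N) /\
    (#|N| <= #|V| ^ (\sum_(i <- window n) spread F i))%N.
Proof.
move=> nQ.
pose S : seq I :=
  flatten [seq enum_fset [fset tau g i | g in F]%fset | i <- window n].
have sizeS : size S = (\sum_(i <- window n) spread F i)%N.
  by rewrite size_flatten sumnE /shape !big_map.
pose decode (t : (size S).-tuple V) : X := fun i => nth v0 t (index i S).
exists [set name Q (decode t) | t : (size S).-tuple V]; split; last first.
  by rewrite -sizeS -card_tuple; exact: leq_imset_card.
move=> u; apply/imsetP; exists (map_tuple u (in_tuple S)) => //.
apply/ffunP => g; rewrite !ffunE; apply: nQ => i ni.
have gS : tau (val g) i \in S.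
  apply/flattenP; exists (enum_fset [fset tau g i | g in F]%fset).
    by apply/mapP; exists i => //; exact: mem_window.
  by apply/imfsetP; exists (val g) => //=; exact: valP.
by rewrite /relabel /decode /= (nth_map (tau (val g) i)) ?index_mem ?nth_index.
Qed.

End Names.

Section Entropy.
Variables (mu : probability (borel X) R) (k : nat) (P : borel X -> 'I_k).
Hypothesis mP : measurable_fibers P.
Hypothesis mu_inv : invariant_measure relabel mu.

(** The joint law of the [P]-name and the [Q]-name of a random point, for a
    cylinder approximation [Q] of [P], is fed to [entropy_le_hamming]; invariance
    makes the probability of disagreement the same at all letters.  The window is
    chosen before [F]. *)
Lemma shannon_entropy_le_spread (d eta : R) : 0 < d < 1 -> 0 < eta ->
  exists n, forall F : {fset G},
  shannon_entropy mu (refined_partition relabel (F := F)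
    (fun i => P @^-1` [set i])) <=
  (\sum_(i <- window n) spread F i)%:R * ln #|V|%:R +
  #|` F|%:R * (- ln (1 - d) + eta * ln (k%:R / d)).
Proof.
move=> /andP[d0 d1] eta0.
have k0 : (0 < k)%N by exact: leq_ltn_trans (ltn_ord (P point)).
have V0 : (0 < #|V|)%N by apply/card_gt0P; exists v0.
have [n [Q [nQ Qeta]]] := cylinder_partition mu mP eta0.
exists n => F; have [N [nameN cardN]] := card_names F nQ.
have mQ : measurable_fibers (Q : borel X -> 'I_k).
  by move=> i; apply: (@cylinder_measurable _ _ _ _ n) => u v /nQ /= ->.
have mname (Q' : borel X -> 'I_k) : measurable_fibers Q' ->
    measurable_fibers (name F Q' : borel X -> _).
  move=> mQ'; apply: measurable_fibers_ffun => g i.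
  exact: (relabel_measurable (val g) (mQ' i)).
have mZ := measurable_fibers_pair (mname _ mP) (mname _ mQ).
set Z := (fun t => _) in mZ.
pose r z := fine (mu (Z @^-1` [set z])).
have marginal w : fine (mu (refined_partition relabel (F := F)
    (fun i => P @^-1` [set i]) w)) = \sum_u r (w, u).
  have := probability_preimage_sum mu (fun z => z.1 == w) mZ.
  rewrite (_ : _ @^-1` _ = refined_partition relabel (F := F)
    (fun i => P @^-1` [set i]) w) => [->|].
    rewrite -(big_pred1_eq +%R w (fun a => \sum_u r (a, u))) pair_big_dep/=.
    by apply: eq_big => [z|[a b] _] //=; rewrite andbT.
  apply/seteqP; split=> t /= => [/eqP<- g _ /=|tw]; first by rewrite ffunE.
  by apply/eqP/ffunP => g; rewrite ffunE; exact: tw.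
have := @entropy_le_hamming R F 'I_k N d _ d0 d1 r eta.
rewrite card_ord -cardfE => /(_ k0) bound.
rewrite /shannon_entropy.
rewrite (eq_bigr (fun w => (\sum_u r (w, u)) * ln (\sum_u r (w, u)))); last first.
  by move=> w _; rewrite marginal.
apply: le_trans (bound _ _ _ _) _.
- by move=> z; exact: fine_ge0.
- rewrite -(probability_preimage_sum mu xpredT mZ) (_ : _ @^-1` _ = setT).
    by rewrite probability_setT.
  by apply/seteqP; split.
- move=> [w u] /= uN; rewrite /r (_ : _ @^-1` _ = set0) ?measure0//.
  rewrite -subset0 => t /= [_ tu]; move/negP: uN; apply; rewrite -tu.
  exact: nameN.
- move=> g; rewrite -(probability_preimage_sum mu 
    (fun z : {ffun F -> 'I_k} * {ffun F -> 'I_k} => z.2 g != z.1 g) mZ).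
  rewrite (_ : _ @^-1` _ = relabel (val g) @^-1` [set u | Q u != P u]).
    rewrite mu_inv//.
    exact: (measurable_fibers_preimage [set z | z.1 != z.2]
      (measurable_fibers_pair mQ mP)).
  by apply/seteqP; split=> t; rewrite /= !ffunE.
- rewrite lerD2r mulr_natl -lnXn ?ltr0n// -natrX ler_ln ?posrE ?ltr0n ?expn_gt0 ?V0//.
    by rewrite ler_nat.
  by apply/card_gt0P; exists (name F Q point).
Qed.

Lemma partition_entropy_le0 (F : nat -> {fset G}) :
  (forall n, F n != fset0) ->
  (forall i, (fun n => (spread (F n) i)%:R / #|` F n|%:R : R) @ \oo --> (0 : R)) ->
  (partition_entropy relabel F mu (fun i => P @^-1` [set i]) <= 0)%E.
Proof.
move=> F0 slow; apply/lee_addgt0Pr => e e0; rewrite add0e.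
have e30 : 0 < e / 3 by rewrite divr_gt0.
(* The noise level is chosen so that the term [- ln (1 - d)] is exactly
   [e / 3]; then [eta] makes the second error term at most [e / 3]. *)
pose d : R := 1 - expR (- (e / 3)).
have d01 : 0 < d < 1.
  by rewrite /d subr_gt0 expR_lt1 oppr_lt0 e30 gtrBl expR_gt0.
have lnd : - ln (1 - d) = e / 3 by rewrite /d subKr expRK opprK.
have k0 : (0 < k)%N by exact: leq_ltn_trans (ltn_ord (P point)).
have b0 : 0 <= ln (k%:R / d).
  case/andP: d01 => d0 d1; apply: ln_ge0; rewrite ler_pdivlMr// mul1r.
  by rewrite (le_trans (ltW d1))// ler1n.
pose eta := e / 3 / (ln (k%:R / d) + 1).
have b10 : 0 < ln (k%:R / d) + 1 by rewrite ltr_wpDl.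
have eta0 : 0 < eta by rewrite divr_gt0.
have etab : eta * ln (k%:R / d) <= e / 3.
  rewrite /eta -mulrA ler_piMr ?(ltW e30)// mulrC ler_pdivrMr// mul1r.
  by rewrite lerDl.
have [n nF] := shannon_entropy_le_spread d01 eta0.
have slow_sum : (fun j => (\sum_(i <- window n) spread (F j) i)%:R /
    #|` F j|%:R * ln #|V|%:R : R) @ \oo --> (0 : R).
  rewrite -(mul0r (ln #|V|%:R)); apply: cvgM; last exact: cvg_cst.
  elim: (window n) => [|i s IH].
    rewrite (_ : (fun=> _) = cst 0); first exact: cvg_cst.
    by apply/funext => j; rewrite big_nil mul0r.
  rewrite (_ : (fun=> _) = (fun j => (spread (F j) i)%:R / #|` F j|%:R) \+
    (fun j => (\sum_(i <- s) spread (F j) i)%:R / #|` F j|%:R)).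
    by rewrite -(addr0 0); exact: cvgD.
  by apply/funext => j; rewrite big_cons natrD mulrDl.
have [m _ mF] := cvgr_lt 0 slow_sum _ e30.
rewrite /partition_entropy limn_esup_lim; apply: lime_le; first exact: is_cvg_esups.
exists m => // j /= mj; apply: ub_ereal_sup => _ [l /= jl <-].
have Fl0 : 0 < #|` F l|%:R :> R by rewrite ltr0n cardfs_gt0.
rewrite lee_fin ler_pdivrMr//; apply: le_trans (nF (F l)) _.
rewrite lnd; have := mF l (leq_trans mj jl) => /= /ltW.
rewrite mulrAC ler_pdivrMr// => h.
set c : R := #|` F l|%:R.
rewrite (_ : e * c = e / 3 * c + c * (e / 3 + e / 3)); last by field.
rewrite lerD// ler_wpM2l ?(ltW Fl0)//.
by rewrite lerD2l.
Qed.

End Entropy.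

Lemma measure_entropy_le0 (mu : probability (borel X) R) (F : nat -> {fset G}) :
  invariant_measure relabel mu -> (forall n, F n != fset0) ->
  (forall i, (fun n => (spread (F n) i)%:R / #|` F n|%:R : R) @ \oo --> (0 : R)) ->
  (measure_entropy relabel F mu <= 0)%E.
Proof.
move=> mu_inv F0 slow; apply: ub_ereal_sup => _ [k [P [[mP tP cP] ->]]].
have cell u : exists i, P i u.
  have [i _ Piu] : (\bigcup_i P i) u by rewrite cP.
  by exists i.
have [p Pp] := choice cell.
have PE : P = fun i => (p : borel X -> 'I_k) @^-1` [set i].
  apply/funext => i; apply/seteqP; split=> u /= => [Piu|<-//].
  by apply: (tP (p u) i) => //; exists u; split.
rewrite PE; apply: partition_entropy_le0 => // i.
by have := mP i; rewrite PE.
Qed.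

(** The constant function is a fixed point, so its Dirac mass is invariant; this
    gives the lower bound, since the supremum over the invariant measures would be
    minus infinity if there were none. *)
Lemma topological_entropy_eq0 (F : nat -> {fset G}) :
  (forall n, F n != fset0) ->
  (forall i, (fun n => (spread (F n) i)%:R / #|` F n|%:R : R) @ \oo --> (0 : R)) ->
  topological_entropy (X := X) relabel F = 0%E.
Proof.
move=> F0 slow; apply/eqP; rewrite eq_le; apply/andP; split.
  by apply: ub_ereal_sup => _ [mu mu_inv <-]; exact: measure_entropy_le0.
pose mu : probability (borel X) R := \d_(point : borel X).
have mu_inv : invariant_measure relabel mu by move=> g A mA; rewrite /mu /= !diracE.
apply: (@le_trans _ _ (measure_entropy relabel F mu)); last first.
  by apply: ereal_sup_ubound; exists mu.
apply: (@le_trans _ _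
  (partition_entropy relabel F mu (fun _ : 'I_1 => setT))); last first.
  apply: ereal_sup_ubound; exists 1%N, (fun=> setT); split=> //; split=> [i||] //.
  - by move=> i j _ _ _; rewrite !ord1.
  - by apply/seteqP; split=> // u _; exists ord0.
apply: limf_esup_ge0 => [|n]; first exact: filter_not_empty.
rewrite lee_fin divr_ge0// /shannon_entropy big1 ?oppr0// => w _.
rewrite (_ : refined_partition _ _ _ = setT); last by apply/seteqP; split=> u.
by rewrite probability_setT/= ln1 mulr0.
Qed.

End Reindexing.

(** * Images of Folner sequences under invariant maps *)

Section Folner.
Variables (R : realType) (G : monoidType).

(** From [g] in [F], multiply by [q] until [F] is left for the first time: this
    does not change [c] and ends in [q F \ F]. *)
Lemma card_invariant_image (Y : choiceType) (F : {fset G}) (q : G) (c : G -> Y) :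
  (forall g, c (q * g)%g = c g) ->
  (forall g, exists n, iter n (fun h => q * h)%g g \notin F) ->
  (#|` [fset c g | g in F]%fset| <= #|` ([fset (q * g)%g | g in F] `\` F)%fset|)%N.
Proof.
move=> cq escape.
apply: (@leq_trans
  #|` [fset c g | g in ([fset (q * g)%g | g in F] `\` F)%fset]%fset|).
  apply: fsubset_leq_card; apply/fsubsetP => _ /imfsetP[g /= gF ->].
  pose esc n := iter n (fun h => q * h)%g g \notin F.
  have cg n : c (iter n (fun h => q * h)%g g) = c g.
    by elim: n => //= n <-.
  case: (@ex_minnP esc (escape g)) => -[|n]; rewrite /esc /= ?gF// => nF min.
  rewrite -(cg n.+1); apply: in_imfset; rewrite /= in_fsetD nF /=.
  apply: in_imfset => /=; apply: contraT => /min.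
  by rewrite ltnn.
exact: leq_imfset_card.
Qed.

Lemma folner_invariant_image (Y : choiceType) (F : nat -> {fset G}) (q : G)
    (c : G -> Y) :
  (forall g, c (q * g)%g = c g) ->
  (forall (A : {fset G}) g, exists n, iter n (fun h => q * h)%g g \notin A) ->
  folner R F ->
  (fun n => #|` [fset c g | g in F n]%fset|%:R / #|` F n|%:R : R) @ \oo --> (0 : R).
Proof.
move=> cq escape [F0 /(_ [fset q]%fset)]; rewrite -cardfs_gt0 cardfs1 => /(_ isT) /=.
apply: squeeze_cvgr; last exact: cvg_cst.
apply: nearW => n; rewrite divr_ge0//= ler_pM2r ?invr_gt0 ?ltr0n ?cardfs_gt0//.
rewrite ler_nat; apply: leq_trans (card_invariant_image cq (escape (F n))) _.
apply: fsubset_leq_card; apply/fsubsetP => h; rewrite !in_fsetD in_fsetU !in_fsetD.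
case/andP=> -> /imfsetP[g /= gF ->]; apply/orP; left.
by apply: in_imfset2 => //=; rewrite inE.
Qed.

End Folner.

(** * The 2-part and the odd part of a positive integer *)

HB.instance Definition _ := [Countable of posnat by <:].

Definition prime_class (d : bool) : nat_pred := if d then 2%N : nat_pred else negn 2%N.

(** The 2-part for [true], the odd part for [false]. *)
Definition dyadic_part (d : bool) (g : posnat) : posnat :=
  PosNat (part_gt0 (prime_class d) g).

Lemma dyadic_partM d (g h : posnat) :
  dyadic_part d (g * h)%g = (dyadic_part d g * dyadic_part d h)%g.
Proof. by apply/val_inj; rewrite /= partnM ?posnat_gt0. Qed.

Lemma dyadic_part1 d : dyadic_part d 1%g = 1%g.
Proof. by apply/val_inj; rewrite /= partn1. Qed.

Lemma posnat_escape (q : posnat) (A : {fset posnat}) (g : posnat) : (1 < q)%N ->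
  exists n, iter n (fun h => q * h)%g g \notin A.
Proof.
move=> q1; pose B := (\max_(h <- A) nat_of_posnat h)%N; exists B.
have lt n : (n < iter n (fun h : posnat => q * h)%g g)%N.
  elim: n => [|n IH]; first exact: posnat_gt0.
  apply: (leq_ltn_trans IH) => /=; rewrite -[ltnLHS]mul1n ltn_pmul2r //.
  exact: posnat_gt0.
apply/negP => BA; have := lt B; rewrite ltnNge => /negP; apply.
by rewrite /B; apply: (leq_bigmax_seq (F := nat_of_posnat)) BA isT.
Qed.

Lemma dyadic_part_kernel d : exists2 q : posnat,
  (1 < q)%N & forall g, dyadic_part d (q * g)%g = dyadic_part d g.
Proof.
(* This is 3 when [d] is [true] and 2 when [d] is [false]. *)
exists (PosNat (ltn0Sn d.+1)) => [|g]; first by case: d.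
rewrite dyadic_partM (_ : dyadic_part _ _ = 1%g) ?mul1g//.
by apply/val_inj/eqP; rewrite /= partn_eq1//; case: d; rewrite pnatE.
Qed.

Lemma sorted_filter_min m (s : seq nat) : sorted ltn s -> all (leq m) s ->
  s = [seq r <- s | r == m] ++ [seq r <- s | r != m].
Proof.
case: s => [//|p s] /= ps /andP[mp _].
have ms : all (ltn m) s.
  by apply/allP => r /(allP (order_path_min ltn_trans ps)) /(leq_ltn_trans mp).
have -> : [seq r <- s | r == m] = [::].
  by apply/eqP; rewrite -(negbK (_ == _)) -has_filter; apply/hasPn => r
    /(allP ms) /= /gtn_eqF ->.
have -> : [seq r <- s | r != m] = s.
  by apply/all_filterP/allP => r /(allP ms) /= /gtn_eqF ->.
by case: eqVneq.
Qed.

(** Translation by the two parts of [g] separately, one on each copy of the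
    semigroup. *)
Definition dyadic_translation (g : posnat) (i : posnat * bool) : posnat * bool :=
  ((i.1 * dyadic_part i.2 g)%g, i.2).

Section ExponentWord.
Variables (b : nat) (b_gt1 : (1 < b)%N).

(** The prime 2 is the least one, so its exponent is written last. *)
Lemma exponent_word_dyadic N : exponent_word b_gt1 N =
  exponent_word b_gt1 (dyadic_part false N) ++
  exponent_word b_gt1 (dyadic_part true N).
Proof.
have N0 := posnat_gt0 N.
have log2 : logn 2 (partn N 2%N) = logn 2 N by exact: logn_part.
have log_odd p : p != 2%N -> logn p (partn N (negn 2%N)) = logn p N.
  move=> p2; rewrite -{2}(partnC 2%N N0) lognM ?part_gt0// p_part lognX.
  by rewrite [logn p 2]logn_prime// (negPf p2) muln0.
have min2 : all (leq 2) (primes N).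
  by apply/allP => p; rewrite mem_primes => /andP[/prime_gt1].
have primes2 : primes (partn N 2%N) = [seq r <- primes N | r == 2%N].
  by rewrite primes_part; apply: eq_filter.
have primes_odd : primes (partn N (negn 2%N)) = [seq r <- primes N | r != 2%N].
  by rewrite primes_part; apply: eq_filter.
rewrite /exponent_word {1}(sorted_filter_min (sorted_primes N) min2).
rewrite rev_cat map_cat flatten_cat /= primes2 primes_odd.
congr (flatten _ ++ flatten _).
  apply/eq_in_map => p; rewrite mem_rev mem_filter => /andP[p2 _].
  by rewrite log_odd.
apply/eq_in_map => p; rewrite mem_rev mem_filter => /andP[/= /eqP-> _].
by rewrite log2.
Qed.
End ExponentWord.

(** * Automatic functions are strongly deterministic *)

Theorem proposition7p9 (R : realType) (b : nat) (b_gt1 : (1 < b)%N)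
    (Lam : finType) (iota : Lam -> R) (iota_inj : injective iota)
    (x : posnat -> Lam) (x_aut : automatic b_gt1 x) :
  strongly_deterministic (fun N : posnat => iota (x N)).
Proof.
have [S [s0 [alpha [omega xE]]]] := x_aut.
pose V : finType := {ffun S -> S}; pose v0 : V := [ffun s => s].
pose X := symbolic R (posnat * bool)%type v0.
pose T := @relabel R (posnat * bool)%type V v0 posnat dyadic_translation.
pose phi (u : X) : R := iota (omega (u (1%g, true) (u (1%g, false) s0))).
pose run s w := foldl (fun s v => alpha v s) s w.
pose x0 : X := fun i => [ffun s => run s (exponent_word b_gt1 i.1)].
exists X, T, phi, x0; split.
- exact: symbolic_compact.
- split=> [g|u|g h u]; first exact: relabel_continuous.
    by apply/funext => -[h d]; rewrite /T /relabel /dyadic_translation/=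
      dyadic_part1 mulg1.
  apply/funext => -[k d]; rewrite /T /relabel /dyadic_translation/=.
  by rewrite dyadic_partM mulgA.
- move=> F FF; apply: topological_entropy_eq0; first by case: FF.
  move=> [k d]; have [q q1 qd] := dyadic_part_kernel d.
  apply: (folner_invariant_image (q := q)) FF => [g|A g].
    by rewrite /dyadic_translation /= qd.
  exact: posnat_escape.
- move=> u A /nbhs_singleton Au; apply/nbhs_symbolic.
  exists (maxn (choice.pickle (1%g : posnat, true))
    (choice.pickle (1%g : posnat, false))).+1.
  move=> v uv; rewrite /= /phi -!uv// ltnS ?leq_maxl ?leq_maxr//.
- move=> N; rewrite xE /phi /T /x0 /relabel /dyadic_translation /= !mul1g !ffunE.
  by rewrite exponent_word_dyadic foldl_cat.
Qed.
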